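(* Let $n \ge 4$ be an even integer. Then ${\sf s}(D_{2n} \times C_2) = 2n + 2$ and ${\sf \eta}(D_{2n} \times C_2) = n + 3$. In particular, ${\sf s}(D_{2n} \times C_2) = {\sf \eta}(D_{2n} \times C_2) + \exp(D_{2n} \times C_2) - 1$.
   Context: $D_{2n}$ is the dihedral group of order $2n$ and $C_2$ the cyclic group of order $2$. For a finite group $G$, a sequence over $G$ is a finite unordered list of elements of $G$ with repetitions allowed; for $S = g_1\cdots g_k$, $\pi(S)$ is the set of all products $g_{\tau(1)}\cdots g_{\tau(k)}$ over permutations $\tau$. ${\sf s}(G)$ is the smallest $\ell>0$ such that every sequence over $G$ of length at least $\ell$ has a subsequence $T$ of length $\exp(G)$ with $1\in\pi(T)$. ${\sf \eta}(G)$ is the smallest $\ell>0$ such that every sequence over $G$ of length at least $\ell$ has a subsequence $T$ with $1 \le |T| \le \exp(G)$ and $1 \in \pi(T)$. *)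

(* Defs.v *)
From HB Require Import structures.
From mathcomp Require Import all_boot all_algebra all_fingroup all_solvable.
From mathcomp Require Import boolp.

Set Implicit Arguments.
Unset Strict Implicit.
Unset Printing Implicit Defensive.

Local Open Scope group_scope.

(* Unordered sequences over G are represented by lists, in an arbitrary order.
   Every sub-multiset of a list S is, up to reordering, some T with
   [subseq T S], and [product_set] does not depend on the order of T. *)

Definition product_set (gT : finGroupType) (T : seq gT) : {set gT} :=
  [set g in [seq \prod_(x <- t) x | t <- permutations T]].

Definition s_property (gT : finGroupType) (G : {group gT}) (l : nat) : Prop :=
  forall S : seq gT, {subset S <= G} -> l <= size S ->
    exists T : seq gT,
      [/\ subseq T S, size T = exponent G & 1 \in product_set T].

Definition eta_property (gT : finGroupType) (G : {group gT}) (l : nat) : Prop :=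
  forall S : seq gT, {subset S <= G} -> l <= size S ->
    exists T : seq gT,
      [/\ subseq T S, 1 <= size T <= exponent G & 1 \in product_set T].

Lemma s_property_exists (gT : finGroupType) (G : {group gT}) :
  exists l, (0 < l) && `[< s_property G l >].
Proof.
exists (#|G| * exponent G)%N; rewrite muln_gt0 cardG_gt0 exponent_gt0 /=.
apply/asboolP => S sSG leS.
have [g Gg leg] : exists2 g, g \in G & exponent G <= count_mem g S.
  apply/exists_inP; apply: contraLR leS => /exists_inPn noG; rewrite -ltnNge.
  have -> : size S = \sum_(g in G) count_mem g S.
    elim: S sSG {noG} => [|x S IHS] sSG; first by rewrite big1.
    rewrite /= big_split /= -IHS => [|y Sy]; last first.
      by apply: sSG; rewrite inE Sy orbT.
    rewrite (bigD1 x) ?sSG ?mem_head //= eqxx big1 // => y /andP[_ nyx].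
    by rewrite eq_sym (negPf nyx).
  rewrite -sum_nat_const (bigD1 1) //= [X in _ < X](bigD1 1) //= -addSn.
  apply: leq_add; first by rewrite ltnNge noG.
  by apply: leq_sum => g /andP[Gg _]; rewrite ltnW // ltnNge noG.
exists (nseq (exponent G) g); split; last 1 first.
- rewrite inE; apply/mapP; exists (nseq (exponent G) g).
    by rewrite mem_permutations.
  by rewrite big_nseq -Monoid.iteropE -[iterop _ _ _ _]/(g ^+ _) expg_exponent.
- apply: (@subseq_trans _ (nseq (count_mem g S) g)).
    by rewrite -(subnKC leg) nseqD prefix_subseq.
  have /all_pred1P := filter_all (pred1 g) S; rewrite size_filter => <-.
  exact: filter_subseq.
- by rewrite size_nseq.
Qed.

Lemma eta_property_exists (gT : finGroupType) (G : {group gT}) :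
  exists l, (0 < l) && `[< eta_property G l >].
Proof.
have [l /andP[l0 /asboolP Pl]] := s_property_exists G; exists l.
rewrite l0; apply/asboolP => S sSG leS; have [T [sTS szT T1]] := Pl S sSG leS.
by exists T; split; rewrite // szT leqnn exponent_gt0.
Qed.

Definition s_invariant (gT : finGroupType) (G : {group gT}) : nat :=
  ex_minn (s_property_exists G).

Definition eta_invariant (gT : finGroupType) (G : {group gT}) : nat :=
  ex_minn (eta_property_exists G).

(* ['D_m] is the dihedral group of order m; ['Z_2], seen as a group, is the
   additive group of integers mod 2. *)
Definition dihedral_times_C2 (n : nat) : {group 'D_(2 * n) * 'Z_2} :=
  setX [set: 'D_(2 * n)] [set: 'Z_2].

(* Main.v *)
From HB Require Import structures.
Require Import Defs.
From mathcomp Require Import all_boot all_order all_algebra all_fingroup all_solvable.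
From mathcomp Require Import zify boolp.

(* Elements of [D_2n x C_2] are coded as [x ^ i * y ^ r] with a flag; in a product
   the exponents of [x] add up with signs, a reflection flipping every later sign.

   Since [eta <= s - n + 1] (append [n - 1] copies of 1), everything follows from
   [s <= 2n + 2] and from the sequence [x ^ (n - 1), z, xz, y], which has no short
   product-one subsequence.

   Upper bound.  If it holds for [n], then it holds for [p n] with [p] prime: extract
   [2p - 1] disjoint blocks of length [n] whose products have exponents divisible
   by [n], and apply Erdos-Ginzburg-Ziv.  This leaves [n = 2p].  There, split the
   sequence into pairs with equal image in [C_2 ^ 3] plus a remainder [r] with distinct
   images.  If [r] has at most 4 terms there are [2p - 1] pairs, and
   Erdos-Ginzburg-Ziv applies again.  Otherwise [r] meets at least 6 of the 8 classes,
   so it yields quadruples with trivial image and 2 or 4 reflections.  For [p = 2],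
   such a quadruple that does not commute already works.  For odd [p], rotations placed
   between two reflections carry arbitrary signs, and [p - 1] nonzero terms have
   signed sums covering all of [Z / p]; when too few terms are nonzero, enough pairs
   vanish modulo [p]. *)

Set Implicit Arguments.
Unset Strict Implicit.
Unset Printing Implicit Defensive.

Import GRing.Theory.

(** * Coordinates on the dihedral group *)

Open Scope group_scope.

Lemma dihedral_generators (n : nat) : 1 < n ->
  exists x y : 'D_(2 * n),
    [/\ #[x] = n, y ^+ 2 = 1, x ^ y = x^-1, y \notin <[x]>
      & forall g, exists (i : nat) (b : bool), g = x ^+ i * y ^+ b].
Proof.
move=> n_gt1; rewrite mul2n.
have := Grp_dihedral n_gt1 [set: 'D_n.*2]%G.
rewrite homg_refl => /esym/existsP[[x y] /= /eqP[defG xn y2 xy]].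
have nxy : <[y]> \subset 'N(<[x]>).
  by rewrite norms_cycle xy groupV cycle_id.
have defXY : <[x]> * <[y]> = [set: 'D_n.*2].
  by rewrite -norm_joinEr // defG.
have ox : #[x] <= n by rewrite dvdn_leq ?order_dvdn ?xn //; lia.
have oy : #[y] <= 2 by rewrite dvdn_leq ?order_dvdn ?y2.
(* With [#[x] <= n] and [#[y] <= 2], this count forces both orders to be maximal and the
   intersection to be trivial. *)
have oxy : (#[x] * #[y] = n.*2 * #|<[x]> :&: <[y]>|)%N.
  by rewrite mul_cardG defXY card_dihedral.
have I0 : 0 < #|<[x]> :&: <[y]>| by rewrite cardG_gt0.
have oxn : #[x] = n by nia.
have oy2 : #[y] = 2%N by nia.
exists x, y; split=> //.
  apply/negP=> yx; have : <[x]> :&: <[y]> = <[y]>.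
    by apply/setIidPr; rewrite cycle_subG.
  by move=> e; move: oxy; rewrite e oxn -orderE oy2; lia.
move=> g; have : g \in <[x]> * <[y]> by rewrite defXY inE.
case/mulsgP=> _ _ /cycleP[i ->] /cycleP[j ->] ->; exists i, (odd j).
congr (_ * _); rewrite -{1}(odd_double_half j) expgD -(mul2n j./2) expgM y2.
by rewrite expg1n mulg1.
Qed.

(* [(i, r, z)] stands for the element [x ^ i * y ^ r] of the dihedral group
   paired with [z] in the cyclic group of order 2. *)
Definition code : predArgType := (nat * bool * bool)%type.
HB.instance Definition _ := Countable.on code.
Definition turn (e : code) := e.1.1.
Definition refl (e : code) := e.1.2.
Definition cent (e : code) := e.2.

(* Exponent of [x] in a product: a factor is inverted when an odd number of
   reflections precede it. *)
Fixpoint val_prod (t : seq code) : int :=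
  if t is e :: t' then ((turn e)%:Z + (-1) ^+ refl e * val_prod t')%R else 0%R.

Lemma val_cat s t :
  val_prod (s ++ t) = (val_prod s + (-1) ^+ odd (count refl s) * val_prod t)%R.
Proof.
elim: s => [|e s IHs] /=; first by rewrite expr0 mul1r add0r.
rewrite IHs mulrDr mulrA -signr_addb oddD addrA.
by congr (_ + _ ^+ _ * _)%R; case: (refl e).
Qed.

Section Decode.
Variables (n : nat) (x y : 'D_(2 * n)).
Hypotheses (n_gt0 : 0 < n) (ox : #[x] = n) (y2 : y ^+ 2 = 1) (xy : x ^ y = x^-1).

Definition decode (e : code) : 'D_(2 * n) * 'Z_2 :=
  (x ^+ turn e * y ^+ refl e, Zp1 ^+ cent e).

Lemma reflection_rotation k : y * x ^+ k = x ^- k * y.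
Proof.
have -> : x ^- k = (x ^+ k) ^ y by rewrite conjXg xy expgVn.
have yV : y^-1 = y by apply/eqP; rewrite eq_invg_mul; apply/eqP.
by rewrite conjgE yV -!mulgA [y * y]y2 mulg1.
Qed.

Lemma rotation_eq (i j : nat) : (i%:Z = j%:Z %[mod n])%Z -> x ^+ i = x ^+ j.
Proof.
by rewrite !modz_nat => -[eq_ij]; apply/eqP; rewrite eq_expg_mod_order ox eq_ij.
Qed.

(** [val_prod] may be negative while exponents of [x] are naturals, hence the natural representative
    [k] modulo [n]. *)
Lemma prod_decode t k : (k%:Z = val_prod t %[mod n])%Z ->
  \prod_(e <- t) decode e
    = (x ^+ k * y ^+ odd (count refl t), Zp1 ^+ odd (count cent t)).
Proof.
elim: t k => [|e t IHt] k /= def_k.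
  rewrite big_nil; congr (_, _); rewrite /= ?mulg1 //.
  apply/esym/eqP; rewrite -order_dvdn ox; move: def_k.
  by move/eqP; rewrite eqz_mod_dvd subr0.
pose k' := `|(val_prod t %% n)%Z|%N.
have def_k' : (k'%:Z = val_prod t %[mod n])%Z.
  by rewrite /k' gez0_abs ?modz_ge0 ?modz_mod //; lia.
rewrite big_cons (IHt _ def_k') /decode; congr (_, _) => /=; last first.
  rewrite oddD oddb; case: (cent e) (odd _) => [] [] //=; exact: val_inj.
rewrite oddD; case: (refl e) def_k => /=.
  rewrite expr1 mulN1r => def_k.
  rewrite expg1 -!mulgA (mulgA y (x ^+ k')) reflection_rotation !mulgA.
  have -> : x ^+ turn e = x ^+ k * x ^+ k'.
    rewrite -expgD; apply: rotation_eq; rewrite PoszD.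
    by rewrite -modzDm def_k def_k' modzDm subrK.
  rewrite mulgK -!mulgA; congr (_ * _).
  by case: (odd _); rewrite /= ?expg0 ?expg1 ?mulg1 // [y * y]y2.
rewrite expr0 mul1r mulg1 mulgA -expgD => def_k.
congr (_ * _); apply: rotation_eq.
by rewrite PoszD -modzDmr def_k' modzDmr def_k.
Qed.

Lemma prod_decode1 t : ~~ odd (count refl t) -> ~~ odd (count cent t) ->
  (n %| val_prod t)%Z -> \prod_(e <- t) decode e = 1.
Proof.
move=> /negbTE rt /negbTE ct /dvdz_mod0P vt.
have e0 : (0%:Z = val_prod t %[mod n])%Z by rewrite vt mod0z.
by rewrite (prod_decode e0) rt ct /= mulg1.
Qed.

Hypotheses (Xy : y \notin <[x]>)
  (genXY : forall g, exists (i : nat) (b : bool), g = x ^+ i * y ^+ b).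

Lemma prod_decode_eq1 t : \prod_(e <- t) decode e = 1 ->
  [/\ ~~ odd (count refl t), ~~ odd (count cent t) & (n %| val_prod t)%Z].
Proof.
pose k := `|(val_prod t %% n)%Z|%N.
have def_k : (k%:Z = val_prod t %[mod n])%Z.
  by rewrite /k gez0_abs ?modz_ge0 ?modz_mod //; lia.
rewrite (prod_decode def_k) => -[xy1 z1].
(* An odd number of reflections would leave [x ^+ k * y = 1], putting [y] into the group generated
   by [x]. *)
have rt : ~~ odd (count refl t).
  apply: contra Xy => rt; move/eqP: xy1; rewrite rt expg1 -eq_invg_mul => /eqP <-.
  by rewrite groupV mem_cycle.
split=> //.
  by apply/negP => ct; move: z1; rewrite ct.
apply/dvdz_mod0P; rewrite -def_k modz_nat; congr Posz; apply/eqP.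
by move/eqP: xy1; rewrite (negbTE rt) mulg1 -order_dvdn ox.
Qed.

Lemma decode_surj g : exists e, decode e = g.
Proof.
case: g => d z; have [i [b ->]] := genXY d.
exists (i, b, val z == 1%N); congr (_, _); rewrite /cent /=.
by apply: val_inj; case: z => [[|[]]].
Qed.

Lemma decode_seq_surj (S : seq ('D_(2 * n) * 'Z_2)) :
  exists S0, S = map decode S0.
Proof.
elim: S => [|g S [S0 ->]]; first by exists [::].
by have [e <-] := decode_surj g; exists (e :: S0).
Qed.

End Decode.

Close Scope group_scope.

(** * Submultisets and sums modulo a prime *)

Section SubMultiset.
Variable T : eqType.
Implicit Types s t : seq T.

(** Quantifying over all predicates gives at once bounds on sizes, multiplicities and numbers of
    reflections, whatever the order. *)
Definition submset t s := forall P : pred T, count P t <= count P s.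

Lemma submset_rest t s : submset t s -> exists r, perm_eq s (t ++ r).
Proof.
move=> sub_ts; have /count_subseqP[t' sub_t' eq_t] x : count_mem x t <= count_mem x s.
  exact: sub_ts.
have [r eq_s] := perm_to_subseq sub_t'; exists r; apply: (perm_trans eq_s).
by rewrite perm_cat2r perm_sym.
Qed.

End SubMultiset.

Section PrimeField.
Variables (p : nat) (p_pr : prime p).
Local Open Scope ring_scope.
Implicit Types (A : {set 'F_p}) (cs : seq ('F_p * 'F_p)).

Lemma card_Fp_eq : #|[set: 'F_p]| = p.
Proof. by rewrite cardsT card_Fp. Qed.

(** A nonzero [d] generates the additive group of ['F_p], so the translates of [a] by multiples of
    [d] are everything. *)
Lemma shift_stable_full A a d :
  a \in A -> d != 0 -> (forall b, b \in A -> b + d \in A) -> A = setT.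
Proof.
move=> Aa d0 Ad; apply/setP => b; rewrite inE.
have Aad k : a + d *+ k \in A.
  by elim: k => [|k IHk]; rewrite ?mulr0n ?addr0 // mulrSr addrA Ad.
suff -> : b = a + d *+ (val ((b - a) / d)) by rewrite Aad.
by rewrite -mulr_natr natr_Zp mulrC divfK // addrC subrK.
Qed.

(** The sumset of the sets [{c.1, c.2}]. *)
Fixpoint choice_sums cs : {set 'F_p} :=
  if cs is c :: cs' then
    [set c.1 + x | x in choice_sums cs'] :|: [set c.2 + x | x in choice_sums cs']
  else [set 0].

Lemma choice_sumsP cs x : x \in choice_sums cs ->
  exists2 m : bitseq, size m = size cs &
    x = \sum_(c <- zip m cs) (if c.1 then c.2.1 else c.2.2).
Proof.
elim: cs x => [|c cs IHcs] x /=.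
  by rewrite inE => /eqP ->; exists [::]; rewrite // big_nil.
rewrite inE => /orP[] /imsetP[z /IHcs[m sz_m ->] ->].
  by exists (true :: m); rewrite /= ?sz_m // big_cons.
by exists (false :: m); rewrite /= ?sz_m // big_cons.
Qed.

Lemma card_choice_sums cs :
  (minn p (count (fun c => c.1 != c.2) cs).+1 <= #|choice_sums cs|)%N.
Proof.
elim: cs => [|c cs IHcs] /=; first by rewrite cards1 geq_minr.
set R := choice_sums cs in IHcs *; set B := _ :|: _.
have card_shift a : #|[set a + x | x in R]| = #|R|.
  by rewrite card_imset //; apply: addrI.
have leRB : (#|R| <= #|B|)%N by rewrite -(card_shift c.1) subset_leq_card ?subsetUl.
have [eq_c|ne_c] /= := eqVneq c.1 c.2; first by rewrite add0n (leq_trans IHcs).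
rewrite add1n; have [ltRB|leBR] := ltnP #|R| #|B|.
  by apply: leq_trans ltRB; move: IHcs; move: #|_| (count _ _) => u v; lia.
(* Without growth the two translates of [R] coincide, so [R] is stable under the shift by
   [c.2 - c.1]. *)
have c1B : [set c.1 + x | x in R] = B.
  by apply/eqP; rewrite eqEcard subsetUl card_shift.
have [R0|[a Ra]] := set_0Vmem R.
  by move: IHcs; rewrite R0 cards0; have := prime_gt0 p_pr; lia.
have RT : R = setT.
  apply: (@shift_stable_full R a (c.2 - c.1)); rewrite ?subr_eq0 1?eq_sym //.
  move=> b Rb; have : c.2 + b \in B by rewrite !inE imset_f ?orbT.
  rewrite -c1B => /imsetP[z Rz eq_z].
  by rewrite addrA (addrC b) eq_z addrAC subrr add0r.
have cardR : #|R| = p by rewrite RT card_Fp_eq.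
by apply: leq_trans leRB; rewrite cardR geq_minl.
Qed.

(* The Cauchy-Davenport bound for two-element sets. *)
Lemma choice_sums_full cs (x : 'F_p) :
    (p.-1 <= count (fun c => c.1 != c.2) cs)%N ->
  exists2 m : bitseq, size m = size cs &
    x = \sum_(c <- zip m cs) (if c.1 then c.2.1 else c.2.2).
Proof.
move=> le_p; apply: choice_sumsP; have p0 := prime_gt0 p_pr.
suff -> : choice_sums cs = setT by rewrite inE.
apply/eqP; rewrite eqEcard subsetT card_Fp_eq.
by have := card_choice_sums cs; lia.
Qed.

Lemma Fp_int_eq0 (k : int) : (k%:~R == 0 :> 'F_p) = (p %| k)%Z.
Proof.
have ch : p \in [pchar 'F_p] by apply: pchar_Fp.
case: k => k; first by rewrite -pmulrn -(dvdn_pcharf ch).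
by rewrite NegzE mulrNz oppr_eq0 -pmulrn -(dvdn_pcharf ch) dvdzE abszN.
Qed.

(** Sort by residue and pair position [i] with position [p.-1 + i], for [i < p.-1]. If some pair has
    equal residues, so have the [p] terms from one to the other. Otherwise Cauchy-Davenport lets one
    choice from each pair cancel the term at position [2 * p.-1]. *)
Lemma EGZ_prime (T : eqType) (f : T -> int) (s : seq T) : (2 * p - 1 <= size s)%N ->
  exists t, [/\ submset t s, size t = p & (p %| \sum_(x <- t) f x)%Z].
Proof.
have p1 := prime_gt1 p_pr; case: s => [|x0 s0]; first by move=> /=; lia.
set s1 := x0 :: s0 => le_s1; clearbody s1.
pose g x : 'F_p := (f x)%:~R.
pose r x y := (val (g x) <= val (g y))%N.
have r_total : total r by move=> x y; apply: leq_total.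
have r_tr : transitive r by move=> x y z; apply: leq_trans.
pose s := sort r s1.
have sz_s : size s = size s1 by rewrite size_sort.
have cnt_s P : count P s = count P s1 by apply/seq.permP; rewrite perm_sort.
have r_nth i j : (i <= j < size s)%N -> r (nth x0 s i) (nth x0 s j).
  move=> ij; apply: (sorted_leq_nth r_tr); rewrite ?inE; try lia.
    by move=> x; apply: leqnn.
  exact: sort_sorted.
suff [t [sub_t sz_t t0]] : exists t, [/\ submset t s, size t = p & \sum_(x <- t) g x = 0].
  exists t; split=> //; first by move=> P; rewrite -cnt_s.
  by rewrite -Fp_int_eq0 rmorph_sum /= t0.
pose c i := (nth x0 s i, nth x0 s (p.-1 + i)%N).
have [/allP all_ne|/allPn[i]] :=
  boolP (all (fun i => g (c i).1 != g (c i).2) (iota 0 p.-1)); last first.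
  rewrite mem_iota add0n negbK => /andP[_ lt_i] /eqP eq_i.
  exists (take p (drop i s)); split.
  - move=> P; rewrite -{2}(cat_take_drop i s) count_cat.
    by rewrite -{2}(cat_take_drop p (drop i s)) count_cat; lia.
  - by rewrite size_takel // size_drop; lia.
  rewrite (eq_big_seq (fun=> g (nth x0 s i))) => [|x]; last first.
    case/(nthP x0) => j; rewrite size_takel ?size_drop; last by lia.
    move=> lt_j <-; rewrite nth_take // nth_drop; apply/val_inj/eqP.
    rewrite eqn_leq [X in _ && X](r_nth i (i + j)%N); last by lia.
    rewrite andbT eq_i; apply: r_nth; lia.
  rewrite big_const_seq count_predT size_takel ?size_drop; last by lia.
  rewrite iter_addr addr0 -mulr_natr.
  by have /pcharf0 -> := pchar_Fp p_pr; rewrite mulr0.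
pose cs := [seq (g (c i).1, g (c i).2) | i <- iota 0 p.-1].
have full : (p.-1 <= count (fun c => c.1 != c.2) cs)%N.
  suff /eqP -> : count (fun c => c.1 != c.2) cs == size cs by rewrite size_map size_iota.
  by rewrite -all_count all_map; apply/allP => i /all_ne.
have [m sz_m sum_m] := choice_sums_full (- g (nth x0 s (2 * p.-1)%N)) full.
pose u := [seq (if d.1 then (c d.2).1 else (c d.2).2) | d <- zip m (iota 0 p.-1)].
have sz_u : size u = p.-1.
  by rewrite size_map size_zip sz_m size_map size_iota minnn.
exists (rcons u (nth x0 s (2 * p.-1)%N)); split.
- move=> P; rewrite -cats1 count_cat /= addn0.
  have le_take : (count P [seq nth x0 s i | i <- iota 0 (p.-1 + p.-1 + 1)]
      <= count P s)%N.
    rewrite map_nth_iota0; last by lia.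
    by rewrite -{2}(cat_take_drop (p.-1 + p.-1 + 1) s) count_cat; lia.
  move: le_take; rewrite !iotaD !map_cat !count_cat /= !add0n addn0 addnn -mul2n.
  have -> : iota p.-1 p.-1 = map (addn p.-1) (iota 0 p.-1) by rewrite -iotaDl addn0.
  rewrite -map_comp; apply: leq_trans.
  rewrite leq_add2r /u; elim: (iota 0 _) (m) => [|i l IHl] [|b m'] //=.
  by have := IHl m'; rewrite /c; case: b => /=; lia.
- by rewrite size_rcons sz_u; lia.
rewrite -cats1 big_cat big_seq1 /=; apply/eqP; rewrite addr_eq0 -[X in _ == X]opprK.
rewrite sum_m opprK /u /cs; apply/eqP.
elim: (iota 0 _) (m) => [|i l IHl] [|b m'] //=; rewrite ?big_nil ?big_cons //=.
by rewrite IHl; case: b.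
Qed.
End PrimeField.

(** * Signed products *)

(** For even [n] this is a homomorphism onto [C_2 ^ 3]; [balanced] says that the product has trivial
    image there, in any order. *)
Definition parity (e : code) := (odd (turn e), refl e, cent e).
Definition balanced (s : seq code) :=
  [&& ~~ odd (count (fun e => odd (turn e)) s), ~~ odd (count refl s)
    & ~~ odd (count cent s)].
Definition unit_product (n : nat) (t : seq code) :=
  [&& ~~ odd (count refl t), ~~ odd (count cent t) & (n %| val_prod t)%Z].
Definition twin (q : code * code) := parity q.1 == parity q.2.
Definition unpair (qs : seq (code * code)) := flatten [seq [:: q.1; q.2] | q <- qs].

Lemma balanced_cat s t : balanced s -> balanced t -> balanced (s ++ t).
Proof.
rewrite /balanced !count_cat !oddD.
by move=> /and3P[/negbTE-> /negbTE-> /negbTE->] /and3P[-> -> ->].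
Qed.

Lemma balanced_perm s t : perm_eq s t -> balanced s = balanced t.
Proof. by move=> /seq.permP eq_st; rewrite /balanced !eq_st. Qed.

Lemma balanced_unpair qs : all twin qs -> balanced (unpair qs).
Proof.
elim: qs => //= q qs IHqs /andP[/eqP[o r c] /IHqs]; apply: (@balanced_cat [:: _; _]).
by rewrite /balanced /= o r c !addn0 !oddD !addbb.
Qed.

Lemma val_prod_even t :
  (2 %| val_prod t)%Z = ~~ odd (count (fun e => odd (turn e)) t).
Proof.
suff : (val_prod t %% 2)%Z = (count (fun e => odd (turn e)) t %% 2)%Z.
  by move=> eq2; apply/dvdz_mod0P/idP; rewrite eq2; lia.
elim: t => //= e t IHt; case: (refl e); rewrite ?expr0 ?expr1; lia.
Qed.

(** As [p] is odd, divisibility by 2 and by [p] can be treated apart, and the former holds in every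
    order of a balanced list. *)
Lemma balanced_unit_product p t : odd p -> balanced t -> (p %| val_prod t)%Z ->
  unit_product (2 * p) t.
Proof.
move=> p_odd /and3P[o_t r_t c_t] p_t; rewrite /unit_product r_t c_t /=.
have : coprimez 2 p by rewrite coprimezE coprime2n.
by move/Gauss_dvdz; rewrite PoszM => ->; rewrite p_t val_prod_even o_t.
Qed.

Lemma val_rotations t : all (fun e => ~~ refl e) t ->
  val_prod t = (\sum_(e <- t) (turn e)%:Z)%R.
Proof.
elim: t => [|e t IHt] /=; first by rewrite big_nil.
by move=> /andP[/negbTE-> /IHt->]; rewrite big_cons expr0 mul1r.
Qed.

Lemma val_flatten bs : all (fun b => ~~ odd (count refl b)) bs ->
  val_prod (flatten bs) = (\sum_(b <- bs) val_prod b)%R.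
Proof.
elim: bs => [|b bs IHbs] /=; first by rewrite big_nil.
by move=> /andP[/negbTE rb /IHbs]; rewrite val_cat rb expr0 mul1r big_cons => ->.
Qed.

Section Sandwich.
Variables (p : nat) (p_pr : prime p) (p_odd : odd p).

Definition zero_or_many (ds : seq int) :=
  all (fun d => (p %| d)%Z) ds \/ p.-1 <= count (fun d => ~~ (p %| d)%Z) ds.

(** In the second case apply the two-element Cauchy-Davenport bound to the pairs [(- d, d)], which
    are nondegenerate for [d] nonzero because [p] is odd. *)
Lemma signed_sum_eq0 ds : zero_or_many ds ->
  exists2 m : bitseq, size m = size ds &
    (p %| (\sum_(c <- zip m ds) (-1) ^+ c.1 * c.2)%R)%Z.
Proof.
case=> [all0 | many].
  exists (nseq (size ds) false); first by rewrite size_nseq.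
  elim: ds all0 => [|d ds IHds] /=; first by rewrite big_nil dvdz0.
  by move=> /andP[pd /IHds]; rewrite big_cons expr0 mul1r; apply: rpredD.
pose F (d : int) : 'F_p := (d%:~R)%R.
have [] := @choice_sums_full p p_pr [seq (- F d, F d)%R | d <- ds] 0%R.
  apply: leq_trans many _; rewrite count_map; apply: sub_count => d /=.
  rewrite -(Fp_int_eq0 p_pr) -/(F d); apply: contra => /eqP eq_d.
  have : (F (2 * d) == 0)%R.
    by rewrite /F rmorphM /= -/(F d) mulr_natl mulr2n -{1}eq_d addNr.
  by rewrite !(Fp_int_eq0 p_pr) Gauss_dvdzr // coprimezE coprimen2.
move=> m; rewrite size_map => sz_m sum_m; exists m => //.
rewrite -(Fp_int_eq0 p_pr) rmorph_sum /= [X in _ == X]sum_m; apply/eqP.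
elim: ds m {many sz_m sum_m} => [|d ds IHds] [|b m] //=; rewrite ?big_nil ?big_cons //=.
by rewrite IHds rmorphM rmorph_sign /=; case: b; rewrite ?mulN1r ?mul1r.
Qed.

(** Blocks with sign [+] go to [u], the others to [v]; values add up because each block has an even
    number of reflections. *)
Lemma signed_blocks bs (m : bitseq) : all (fun b => ~~ odd (count refl b)) bs ->
  size m = size bs -> exists u v,
  [/\ perm_eq (u ++ v) (flatten bs), ~~ odd (count refl u), ~~ odd (count refl v)
    & (val_prod u - val_prod v
       = \sum_(c <- zip m (map val_prod bs)) (-1) ^+ c.1 * c.2)%R].
Proof.
elim: bs m => [|b bs IHbs] [|s m] //=.
  by exists [::], [::]; rewrite big_nil subrr.
move=> /andP[rb rbs] [sz_m]; have [u [v [eq_uv ru rv val_uv]]] := IHbs m rbs sz_m.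
have rcat w : ~~ odd (count refl w) -> ~~ odd (count refl (b ++ w)).
  by rewrite count_cat oddD (negbTE rb).
have vcat w : val_prod (b ++ w) = (val_prod b + val_prod w)%R.
  by rewrite val_cat (negbTE rb) expr0 mul1r.
rewrite big_cons -val_uv /=; case: s; [exists u, (b ++ v) | exists (b ++ u), v].
all: split; rewrite ?rcat ?vcat //=; try (by rewrite ?expr0 ?expr1; lia).
all: apply/seq.permP => P; move/seq.permP/(_ P): eq_uv; rewrite !count_cat; lia.
Qed.

(* Between two reflections every block is inverted, so each rotation block can
   be given an arbitrary sign. *)
Lemma sandwich (t1 t2 : code) bs : refl t1 -> refl t2 ->
    all (fun b => ~~ odd (count refl b)) bs ->
    zero_or_many ((turn t1)%:Z - (turn t2)%:Z :: map val_prod bs)%R ->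
  exists2 t, perm_eq t (t1 :: t2 :: flatten bs) & (p %| val_prod t)%Z.
Proof.
move=> r1 r2 rbs /signed_sum_eq0[[|s m] //=]; rewrite size_map => -[sz_m] p_sum.
(* Only signs relative to that of the first term matter: multiplying all of them by [(-1) ^+ s]
   gives [turn t1 - turn t2] the sign [+]. *)
pose m' := map (addb s) m.
have [|u [v [eq_uv ru rv val_uv]]] := signed_blocks (m := m') rbs.
  by rewrite size_map.
(* Its value is [val_prod u + turn t1 - val_prod v - turn t2]. *)
exists (u ++ t1 :: v ++ [:: t2]).
  apply/seq.permP => P; move/seq.permP/(_ P): eq_uv.
  by rewrite !count_cat /= !count_cat /=; lia.
rewrite val_cat (negbTE ru) /= val_cat (negbTE rv) /= r1 r2 !expr0 !expr1.
set V := (X in (p %| X)%Z); suff -> : (V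
   = (-1) ^+ s * \sum_(c <- zip (s :: m) ((turn t1)%:Z - (turn t2)%:Z :: map val_prod bs)) (-1) ^+ c.1 * c.2)%R.
  exact: dvdz_mull.
rewrite big_cons mulrDr mulrA -signr_addb addbb mul1r /=.
have -> : ((-1) ^+ s * \sum_(c <- zip m (map val_prod bs)) (-1) ^+ c.1 * c.2
    = val_prod u - val_prod v)%R.
  rewrite val_uv /m'; elim: (map _ bs) (m) => [|d ds IHds] [|a l] //=.
  - by rewrite !big_nil mulr0.
  - by rewrite !big_nil mulr0.
  - by rewrite !big_nil mulr0.
  by rewrite !big_cons mulrDr IHds mulrA -signr_addb.
rewrite /V; lia.
Qed.
End Sandwich.

(** * Pairing elements of equal parity *)

(** A block must contain an even number of reflections: a pair of reflections stays together, while
    two rotations can be signed independently. *)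
Definition pieces (q : code * code) :=
  if refl q.1 then [:: [:: q.1; q.2]] else [:: [:: q.1]; [:: q.2]].
(* Every product of the elements of such a pair has exponent 0 modulo [p]. *)
Definition flat p (q : code * code) := all (fun b => (p %| val_prod b)%Z) (pieces q).

Definition has_unit n (s : seq code) :=
  exists t, [/\ submset t s, size t = n & unit_product n t].

Lemma submset_trans (T : eqType) (s t u : seq T) :
  submset s t -> submset t u -> submset s u.
Proof. by move=> st tu P; apply: leq_trans (st P) (tu P). Qed.

Lemma submset_all (T : eqType) (a : pred T) (s t : seq T) :
  submset t s -> all a s -> all a t.
Proof.
move=> sub_ts; apply: contraLR; rewrite -!has_predC !has_count.
by move=> t0; apply: leq_trans t0 (sub_ts _).
Qed.

Lemma submset_mem (T : eqType) (s t : seq T) :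
  uniq t -> {subset t <= s} -> submset t s.
Proof.
move=> Ut sub_ts.
have /count_subseqP[t' sub_t' /seq.permP eq_t] := leq_uniq_count Ut sub_ts.
by move=> P; rewrite eq_t; apply: leq_count_subseq.
Qed.

Lemma submset_select (T : eqType) (a : pred T) (s : seq T) m k :
  m <= size s -> k <= count a s -> k <= m ->
  exists2 t, submset t s & size t = m /\ k <= count a t.
Proof.
move=> le_m le_k le_km.
have cnt P : count P (filter a s ++ filter (predC a) s) = count P s.
  by apply/seq.permP; rewrite perm_filterC.
have sz_s : size (filter a s ++ filter (predC a) s) = size s.
  by rewrite -!(count_predT (_ ++ _)) cnt count_predT.
exists (take m (filter a s ++ filter (predC a) s)).
  by move=> P; rewrite -cnt; apply: leq_count_subseq; apply: take_subseq.
split; first by rewrite size_takel // sz_s.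
rewrite take_cat size_filter; case: ltnP => [lt_m | le_c].
  rewrite (eqP (_ : count a _ == size (take m (filter a s)))).
    by rewrite size_takel // size_filter ltnW.
  rewrite -all_count; apply/allP => x /mem_take.
  by rewrite mem_filter => /andP[].
by rewrite count_cat count_filter (eq_count (a2 := a)) ?andbb => [|x /=]; rewrite ?andbb; lia.
Qed.

Lemma has_unit_sub n s t : submset t s -> has_unit n t -> has_unit n s.
Proof. by move=> sub_ts [u [/submset_trans sub_u sz_u u1]]; exists u; split; auto. Qed.

Lemma size_unpair qs : size (unpair qs) = 2 * size qs.
Proof. by elim: qs => //= q qs ->; lia. Qed.

Lemma count_unpair P qs :
  count P (unpair qs) = count (preim fst P) qs + count (preim snd P) qs.
Proof. by elim: qs => //= q qs ->; lia. Qed.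

Lemma submset_unpair qs ps : submset qs ps -> submset (unpair qs) (unpair ps).
Proof. by move=> sub P; rewrite !count_unpair leq_add. Qed.

(** Greedy: each new element is paired with a leftover of the same parity, or becomes a leftover
    itself. *)
Lemma twin_decomposition s : exists ps r,
  [/\ perm_eq s (unpair ps ++ r), all twin ps & uniq (map parity r)].
Proof.
elim: s => [|x s [ps [r [eq_s tw_ps Ur]]]]; first by exists [::], [::].
have [/mapP[y ry eq_xy]|new_x] := boolP (parity x \in map parity r).
  exists ((x, y) :: ps), (rem y r); split; last 1 first.
  - by apply: subseq_uniq Ur; apply: map_subseq; apply: rem_subseq.
  - apply/seq.permP => P; have /seq.permP/(_ P) := eq_s; rewrite /= !count_cat -/(unpair ps).
    by have /seq.permP/(_ P) /= := perm_to_rem ry; lia.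
  - by rewrite /= tw_ps /twin /= eq_xy eqxx.
exists ps, (x :: r); split; rewrite //= ?new_x //.
by apply/seq.permP => P; have /seq.permP/(_ P) := eq_s; rewrite /= !count_cat /=; lia.
Qed.

Definition parities : seq (bool * bool * bool) :=
  [:: (false, false, false); (false, false, true); (true, false, false);
      (true, false, true); (false, true, false); (false, true, true);
      (true, true, false); (true, true, true)].

Lemma count_parities r : uniq (map parity r) ->
  count (mem (map parity r)) parities = size r.
Proof.
move=> Ur; rewrite -(size_map parity) -size_filter; apply: perm_size.
apply: uniq_perm => // [|c]; first exact: filter_uniq.
by rewrite mem_filter andb_idr // => _; case: c => [[[] []] []].
Qed.

Lemma size_distinct_parities r : uniq (map parity r) -> size r <= 8.
Proof. by move/count_parities <-; apply: count_size. Qed.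

(** Exhaustive check over the occupied classes. The class [(o, false, z)] is that of a fourth
    element, which may come from elsewhere. *)
Lemma quad_of_parities (P : pred (bool * bool * bool)) o z : 6 <= count P parities ->
  exists o1 z1 o2 z2 o3 z3,
    [/\ P (o1, false, z1), P (o2, true, z2), P (o3, true, z3), (o2, z2) != (o3, z3)
      & (o (+) o1 (+) o2 (+) o3, z (+) z1 (+) z2 (+) z3) = (false, false)].
Proof.
pose B2 := [seq (a, b) | a <- [:: true; false], b <- [:: true; false]].
pose ok (c : (bool * bool) * (bool * bool) * (bool * bool)) :=
  let: ((o1, z1), (o2, z2), (o3, z3)) := c in
  [&& P (o1, false, z1), P (o2, true, z2), P (o3, true, z3), (o2, z2) != (o3, z3)
    & (o (+) o1 (+) o2 (+) o3, z (+) z1 (+) z2 (+) z3) == (false, false)].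
move=> le6; suff : has ok [seq (a, b) | a <- [seq (a, b) | a <- B2, b <- B2], b <- B2].
  case/hasP => -[[[o1 z1] [o2 z2]] [o3 z3]] _ /and5P[? ? ? ? /eqP ?].
  by exists o1, z1, o2, z2, o3, z3.
move: le6; rewrite {}/ok {}/B2 /parities /=.
case: (P (false, false, false)) (P (false, false, true))
  (P (true, false, false)) (P (true, false, true)) => [] [] [] [];
case: (P (false, true, false)) (P (false, true, true))
  (P (true, true, false)) (P (true, true, true)) => [] [] [] [] //=;
by case: o; case: z.
Qed.

Lemma val_pair q :
  val_prod [:: q.1; q.2] = ((turn q.1)%:Z + (-1) ^+ refl q.1 * (turn q.2)%:Z)%R.
Proof. by rewrite /= !mulr0 addr0. Qed.

Lemma twin_val_even q : twin q -> (2 %| val_prod [:: q.1; q.2])%Z.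
Proof.
move=> /eqP[eq_o _ _]; rewrite val_prod_even /= eq_o addn0.
by rewrite oddD addbb.
Qed.

Lemma twin_refl_even q : twin q -> ~~ odd (count refl [:: q.1; q.2]).
Proof. by move=> /eqP[_ eq_r _]; rewrite /= eq_r addn0; case: (refl _). Qed.

Lemma flat_val p q : flat p q -> (p %| val_prod [:: q.1; q.2])%Z.
Proof.
rewrite /flat /pieces; have [r|r] := boolP (refl q.1); first by rewrite /= andbT.
rewrite val_pair (negbTE r) expr0 mul1r /= !mulr0 !addr0 andbT => /andP[? ?].
exact: rpredD.
Qed.

Lemma flatten_pieces qs : flatten (flatten [seq pieces q | q <- qs]) = unpair qs.
Proof.
elim: qs => //= q qs IHqs; rewrite flatten_cat IHqs /pieces.
by case: (refl _).
Qed.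

Lemma val_unpair qs : all twin qs ->
  val_prod (unpair qs) = (\sum_(q <- qs) val_prod [:: q.1; q.2])%R.
Proof.
move=> /allP tw; rewrite val_flatten ?big_map //.
by rewrite all_map; apply/allP => q /tw /twin_refl_even.
Qed.

Section Base.
Variables (p : nat) (p_pr : prime p).

(** Each twin pair has even value; Erdos-Ginzburg-Ziv applied to the halves yields [p] pairs with
    total value divisible by [2 * p]. *)
Lemma EGZ_pairs ps : all twin ps -> 2 * p - 1 <= size ps -> has_unit (2 * p) (unpair ps).
Proof.
move=> tw le_ps; pose f (q : code * code) := (val_prod [:: q.1; q.2] %/ 2)%Z.
have [qs [sub_qs sz_qs p_f]] := EGZ_prime p_pr f le_ps.
have tw_qs := submset_all sub_qs tw.
exists (unpair qs); split; rewrite ?size_unpair ?sz_qs //; first exact: submset_unpair.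
have /and3P[_ r_qs c_qs] := balanced_unpair tw_qs; rewrite /unit_product r_qs c_qs /=.
rewrite val_unpair // (eq_big_seq (fun q => 2 * f q)%R) => [|q /(allP tw_qs) /twin_val_even].
  by rewrite -mulr_sumr PoszM dvdz_mul2l // .
by move/divzK; rewrite mulrC.
Qed.

Hypothesis p_odd : odd p.

(** Each pair that is not flat contributes at least one block nonzero modulo [p]; balance provides
    the factor 2. *)
Lemma sandwich_pairs t1 t2 us qs : refl t1 -> refl t2 ->
    all (fun e => ~~ refl e) us -> all twin qs -> balanced [:: t1, t2 & us] ->
    let twist := ((turn t1)%:Z - (turn t2)%:Z)%R in
    [&& (p %| twist)%Z, all (fun u => p %| turn u) us & all (flat p) qs]
    \/ p.-1 <= ~~ (p %| twist)%Z + count (fun u => ~~ (p %| turn u)) us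
               + count (predC (flat p)) qs ->
  exists2 t, perm_eq t ([:: t1, t2 & us] ++ unpair qs) & unit_product (2 * p) t.
Proof.
move=> r1 r2 r_us tw bal twist H.
pose bs := [seq [:: u] | u <- us] ++ flatten [seq pieces q | q <- qs].
have flat_bs : flatten bs = us ++ unpair qs.
  by rewrite /bs flatten_cat flatten_pieces; congr cat; elim: (us) => //= u l ->.
have all_pieces a : all a (flatten [seq pieces q | q <- qs])
    = all (fun q => all a (pieces q)) qs.
  by elim: (qs) => //= q l IHl; rewrite all_cat IHl.
have r_bs : all (fun b => ~~ odd (count refl b)) bs.
  rewrite all_cat all_map (eq_all (a2 := fun e => ~~ refl e)) ?r_us => [|e /=]; last first.
    by rewrite addn0 oddb.
  rewrite all_pieces; apply/allP => q /(allP tw)/twin_refl_even.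
  rewrite /= /pieces; have [r|r] := boolP (refl q.1); first by rewrite /= r andbT.
  by rewrite /= (negbTE r) !addn0 oddb andbT.
have zm : zero_or_many p (twist :: map val_prod bs).
  case: H => [/and3P[ptw pus pqs]|many]; [left|right].
    rewrite /= ptw all_map all_cat all_map all_pieces; apply/and3P; split=> //.
      by apply: sub_all pus => u /=; rewrite mulr0 addr0 dvdzE.
  apply: leq_trans many _; rewrite /= -addnA leq_add2l count_map count_cat count_map.
  apply: leq_add.
    by apply: sub_count => u /=; rewrite mulr0 addr0 dvdzE.
  elim: (qs) => //= q l IHl; rewrite count_cat; apply: leq_add => //.
  by rewrite /flat -has_predC has_count; case: (count _ _).
have [t eq_t p_t] := sandwich p_pr p_odd r1 r2 r_bs zm.
rewrite flat_bs in eq_t; exists t => //; apply: balanced_unit_product => //.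
by rewrite (balanced_perm eq_t) (@balanced_cat [:: t1, t2 & us]) ?balanced_unpair.
Qed.
End Base.

(** * Twice an odd prime *)

(** Supplies the two outer reflections and one rotation [u] of a balanced quadruple whose other
    rotation [e] is free within its class. Distinct parities of [t1] and [t2] force those of [u] and
    [e] to differ. *)
Lemma distinct_parities_quad r o z : uniq (map parity r) -> 6 <= size r ->
  exists u t1 t2, [/\ {subset [:: u; t1; t2] <= r},
    [/\ ~~ refl u, refl t1, refl t2, t1 != t2 & parity u != (o, false, z)]
    & forall e, parity e = (o, false, z) -> balanced [:: t1; t2; e; u]].
Proof.
move=> Ur; rewrite -(count_parities Ur) => /(quad_of_parities o z).
case=> o1 [z1 [o2 [z2 [o3 [z3 []]]]]].
move=> /mapP[u ru eu] /mapP[t1 rt1 e1] /mapP[t2 rt2 e2].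
move: eu e1 e2; rewrite /parity => -[-> uF ->] [-> t1T ->] [-> t2T ->] ne [eq_o eq_z].
exists u, t1, t2; split; first 1 last.
- rewrite -uF -t1T -t2T; split=> //; first by apply: contra ne => /eqP->.
  apply: contra ne => /eqP[eo ez]; rewrite xpair_eqE.
  move: eq_o eq_z; rewrite eo ez !addbb !addFb.
  move: (odd (turn t1)) (odd (turn t2)) (cent t1) (cent t2); clear.
  by move=> [] [] [] [].
- move=> e [eo er ez]; rewrite /balanced /= er eo ez -uF -t1T -t2T !addn0 !oddD !oddb /=.
  move: eq_o eq_z; move: (odd (turn t1)) (odd (turn t2)) (odd (turn u)).
  move: (cent t1) (cent t2) (cent u) => [] [] [] [] [] []; clear; case: o; by case: z.
by move=> e; rewrite !inE => /or3P[] /eqP->.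
Qed.

Lemma submset_select_all (T : eqType) (a : pred T) (s : seq T) m : m <= count a s ->
  exists2 t, submset t s & size t = m /\ all a t.
Proof.
move=> le_m; have le_sz := leq_trans le_m (count_size a s).
have [t sub_t [sz_t c_t]] := submset_select le_sz le_m (leqnn m).
by exists t; rewrite // all_count eqn_leq count_size sz_t.
Qed.

Section BaseOdd.
Variables (p : nat) (p_pr : prime p) (p_odd : odd p).

Lemma flats_unit ps : all twin ps -> p <= count (flat p) ps ->
  has_unit (2 * p) (unpair ps).
Proof.
move=> tw /submset_select_all[qs sub_qs [sz_qs fl_qs]].
have tw_qs := submset_all sub_qs tw.
exists (unpair qs); split; rewrite ?size_unpair ?sz_qs //; first exact: submset_unpair.
apply: balanced_unit_product; rewrite ?balanced_unpair // val_unpair //.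
by rewrite big_seq; apply: rpred_sum => q /(allP fl_qs)/flat_val.
Qed.

Lemma sandwich_unit s t1 t2 us qs : refl t1 -> refl t2 ->
    all (fun e => ~~ refl e) us -> all twin qs -> balanced [:: t1, t2 & us] ->
    submset ([:: t1, t2 & us] ++ unpair qs) s ->
    size us + 2 * size qs + 2 = 2 * p ->
    let twist := ((turn t1)%:Z - (turn t2)%:Z)%R in
    [&& (p %| twist)%Z, all (fun u => p %| turn u) us & all (flat p) qs]
    \/ p.-1 <= ~~ (p %| twist)%Z + count (fun u => ~~ (p %| turn u)) us
               + count (predC (flat p)) qs ->
  has_unit (2 * p) s.
Proof.
move=> r1 r2 r_us tw bal sub sz twist H.
have [t eq_t u_t] := sandwich_pairs p_pr p_odd r1 r2 r_us tw bal H.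
exists t; split=> //; first by move=> P; rewrite (seq.permP eq_t).
by rewrite (perm_size eq_t) size_cat size_unpair /=; clear -sz; lia.
Qed.

Let p_gt2 : 2 < p.
Proof. by move: p_odd (prime_gt1 p_pr); case: (p) => [|[|[|]]]. Qed.

Variables (ps : seq (code * code)) (r : seq code).
Hypotheses (tw : all twin ps) (Ur : uniq (map parity r)).
Let s := unpair ps ++ r.
Let nonflat := predC (flat p).

Lemma neq_refl a b : refl a -> ~~ refl b -> a != b.
Proof. by move=> ra; apply: contraNneq => <-. Qed.

(** All eight classes occur in [r], so it contains a whole balanced quadruple, to be completed by
    [p - 2] pairs: flat ones if its three contributions vanish modulo [p], non-flat ones
    otherwise. *)
Lemma few_nonflat_unit : size r = 8 -> p.-2 <= count (flat p) ps ->
  p.-2 <= count nonflat ps -> has_unit (2 * p) s.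
Proof.
move=> sz8 le_fl le_nfl.
have : (false, false, false) \in map parity r.
  have := count_parities Ur; rewrite sz8 -[8]/(size parities) => /eqP.
  by rewrite -all_count => /allP/(_ (false, false, false)); apply.
case/mapP => e re /esym par_e.
have le6 : 6 <= size r by rewrite sz8.
have [u [t1 [t2 [sub_r [ru r1 r2 ne_t ne_u] bal]]]] :=
  distinct_parities_quad false false Ur le6.
have re' : ~~ refl e by move: par_e; rewrite /parity => -[_ -> _].
have Uq : uniq [:: t1; t2; e; u].
  have ne_e_u : e != u by apply: contra ne_u => /eqP <-; rewrite par_e.
  by rewrite /= !inE !negb_or ne_t ne_e_u !neq_refl.
have quad qs : submset qs ps -> submset ([:: t1; t2; e; u] ++ unpair qs) s.
  move=> sub_qs P; rewrite count_cat /s count_cat addnC leq_add //.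
    exact: submset_unpair.
  apply: submset_mem => // x; rewrite !inE.
  by case/or4P => /eqP-> //; apply: sub_r; rewrite !inE eqxx ?orbT.
pose twist := ((turn t1)%:Z - (turn t2)%:Z)%R.
have finish qs : submset qs ps -> size qs = p.-2 ->
    [&& (p %| twist)%Z, p %| turn e, p %| turn u & all (flat p) qs] \/
    (~~ [&& (p %| twist)%Z, p %| turn e & p %| turn u] /\ all nonflat qs) ->
  has_unit (2 * p) s.
  move=> sub_qs sz_qs H; apply: (@sandwich_unit s t1 t2 [:: e; u] qs) => //=.
  - by rewrite re' ru.
  - exact: submset_all sub_qs tw.
  - exact: bal.
  - exact: quad.
  - by rewrite sz_qs; clear -p_gt2; lia.
  case: H => [H|[nz nfl]]; [left | right]; first by rewrite andbT -andbA.
  move: nfl; rewrite all_count => /eqP ->; rewrite sz_qs; move: nz; rewrite -/twist !negb_and.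
  move: (p %| twist)%Z (p %| turn e) (p %| turn u) => b1 b2 b3; clear -p_gt2.
  by case: b1; case: b2; case: b3 => //= _; lia.
have [zero|nonzero] := boolP [&& (p %| twist)%Z, p %| turn e & p %| turn u].
  have [qs sub_qs [sz_qs fl_qs]] := submset_select_all le_fl.
  by apply: (finish qs) => //; left; case/and3P: zero => -> -> ->.
have [qs sub_qs [sz_qs nfl_qs]] := submset_select_all le_nfl.
by apply: (finish qs) => //; right.
Qed.

(** The reflections of [q] are the outer ones, around [p - 1] further pairs. *)
Lemma reflection_twin_unit q : q \in ps -> refl q.1 -> p <= size ps ->
  p.-1 <= count nonflat ps -> has_unit (2 * p) s.
Proof.
move=> ps_q r1 le_sz le_nfl.
have /eqP[eq_o eq_r eq_c] := allP tw _ ps_q.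
have r2 : refl q.2 by rewrite -eq_r.
have perm_ps := perm_to_rem ps_q.
(* The difference of the two turns in [q] is nonzero modulo [p] exactly when [q] is not flat, so it
   then counts as one of the [p - 1] nonzero terms. *)
pose ps' := rem q ps; pose k := p.-1 - nonflat q.
have cnt P : count P ps = P q + count P ps' by have /seq.permP -> := perm_ps.
have sz' : size ps = (size ps').+1 by rewrite (perm_size perm_ps).
have le_m : p.-1 <= size ps' by clear -sz' le_sz; lia.
have le_k : k <= count nonflat ps' by move: le_nfl; rewrite cnt /k; clear; lia.
have [qs sub_qs [sz_qs c_qs]] := submset_select le_m le_k (leq_subr _ _).
apply: (@sandwich_unit s q.1 q.2 [::] qs) => //.
- apply: submset_all sub_qs _; apply/allP => x /mem_rem; exact: allP tw x.
- by rewrite /balanced /= eq_o eq_r eq_c !addn0 !oddD !addbb.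
- move=> P; rewrite /s !count_cat; apply: leq_trans (leq_addr _ _).
  have := submset_unpair sub_qs P.
  by rewrite (count_unpair P ps) !cnt (count_unpair P (rem q ps)) -/ps' /=; clear; lia.
- by rewrite sz_qs /=; clear -p_gt2; lia.
have nfl_q : nonflat q = ~~ (p %| ((turn q.1)%:Z - (turn q.2)%:Z)%R)%Z.
  by rewrite /nonflat /= /flat /pieces r1 [all _ _]andbT val_pair r1 expr1 mulN1r.
by right; move: c_qs; rewrite /k nfl_q leq_subLR addn0.
Qed.

(** A non-flat pair is broken up to give a rotation [e] nonzero modulo [p], completed to a quadruple
    by [r]; with [p - 2] other non-flat pairs there are [p - 1] nonzero terms. *)
Lemma rotation_twins_unit : all (fun q => ~~ refl q.1) ps -> 6 <= size r ->
  p.-1 <= count nonflat ps -> has_unit (2 * p) s.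
Proof.
move=> rot_ps le6 le_nfl.
have /hasP[q ps_q nfl_q] : has nonflat ps.
  by rewrite has_count; apply: leq_trans le_nfl; clear -p_gt2; lia.
have /eqP[eq_o eq_r eq_c] := allP tw _ ps_q.
have rot_q := allP rot_ps _ ps_q.
have [e [par_e nz_e sub_e]] : exists e, [/\ parity e = parity q.1, ~~ (p %| turn e)
    & submset [:: e] [:: q.1; q.2]].
  move: nfl_q; rewrite /nonflat /= /flat /pieces (negbTE rot_q) /= !mulr0 !addr0 andbT.
  rewrite negb_and => /orP[nz|nz]; [exists q.1 | exists q.2]; split=> //.
  - by move=> P /=; clear; lia.
  - by rewrite /parity eq_o eq_r eq_c.
  - by move=> P /=; clear; lia.
have re : ~~ refl e by move: par_e => -[_ -> _].
have [u [t1 [t2 [sub_r [ru r1 r2 ne_t ne_u] bal]]]] :=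
  distinct_parities_quad (odd (turn e)) (cent e) Ur le6.
have Uq : uniq [:: t1; t2; u] by rewrite /= !inE !negb_or ne_t !neq_refl.
have perm_ps := perm_to_rem ps_q.
pose ps' := rem q ps.
have cnt P : count P ps = P q + count P ps' by have /seq.permP -> := perm_ps.
have le_nfl' : p.-2 <= count nonflat ps'.
  by move: le_nfl; rewrite cnt; clear -p_gt2; lia.
have [qs sub_qs [sz_qs nfl_qs]] := submset_select_all le_nfl'.
apply: (@sandwich_unit s t1 t2 [:: e; u] qs) => //=.
- by rewrite re ru.
- apply: submset_all sub_qs _; apply/allP => x /mem_rem; exact: allP tw x.
- by apply: bal; rewrite /parity (negbTE re).
- move=> P; rewrite /s /= !count_cat (count_unpair P ps) !cnt.
  have := submset_unpair sub_qs P; rewrite -/ps' (count_unpair P ps').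
  have := sub_e P; have : count P [:: t1; t2; u] <= count P r.
    apply: submset_mem => // x; rewrite !inE => x3; apply: sub_r; rewrite !inE.
    by case/or3P: x3 => ->; rewrite ?orbT.
  by rewrite /=; clear; lia.
- by rewrite sz_qs; clear -p_gt2; lia.
right; move: nfl_qs; rewrite all_count => /eqP ->; rewrite sz_qs nz_e.
by clear -p_gt2; lia.
Qed.

End BaseOdd.

Lemma base_odd p s : prime p -> odd p -> size s = 4 * p + 2 -> has_unit (2 * p) s.
Proof.
move=> p_pr p_odd sz_s; have p_gt1 := prime_gt1 p_pr.
have [ps [r [eq_s tw Ur]]] := twin_decomposition s.
have szE : 2 * size ps + size r = 4 * p + 2.
  by rewrite -sz_s (perm_size eq_s) size_cat size_unpair.
suff : has_unit (2 * p) (unpair ps ++ r).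
  by apply: has_unit_sub => P; rewrite (seq.permP eq_s).
have sub_ps : submset (unpair ps) (unpair ps ++ r) by move=> P; rewrite count_cat leq_addr.
have le8 := size_distinct_parities Ur.
have [le4|gt4] := leqP (size r) 4.
  by apply: (has_unit_sub sub_ps); apply: EGZ_pairs => //; clear -szE le4; lia.
(* The size of [r] is even. *)
have le6 : 6 <= size r by clear -szE gt4; lia.
have [le_fl|lt_fl] := leqP p (count (flat p) ps).
  by apply: (has_unit_sub sub_ps); apply: flats_unit.
have cnt_ps : count (flat p) ps + count (predC (flat p)) ps = size ps.
  exact: count_predC.
(* There are at least [2 * p - 3] pairs and fewer than [p] flat ones, so [few] forces 8 leftovers,
   [p - 1] flat and [p - 2] non-flat pairs. *)
have [few|many] := ltnP (count (predC (flat p)) ps) p.-1.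
  by apply: few_nonflat_unit => //; clear -szE le8 lt_fl cnt_ps few; lia.
have [/hasP[q ps_q r_q]|no_refl] := boolP (has (fun q => refl q.1) ps).
  apply: reflection_twin_unit ps_q r_q _ many => //.
  have p_gt2 : 2 < p by move: p_odd p_gt1; case: (p) => [|[|[|]]].
  by clear -szE le8 p_gt2; lia.
by apply: rotation_twins_unit => //; rewrite all_predC.
Qed.

(** * Order four, and multiplication by a prime *)

(* The orders [t] and [t'] both give an even exponent, and they differ by 2 modulo 4. *)
Lemma two_orders_unit s t t' : balanced t -> uniq t -> {subset t <= s} -> size t = 4 ->
  perm_eq t t' -> (val_prod t' = val_prod t + 2 %[mod 4])%Z -> has_unit 4 s.
Proof.
move=> bal Ut sub_t sz_t eq_t vals; have sub := submset_mem Ut sub_t.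
have /and3P[o_t r_t c_t] := bal; have e2 : (2 %| val_prod t)%Z by rewrite val_prod_even.
have [z4|nz4] := boolP (4 %| val_prod t)%Z.
  by exists t; rewrite /unit_product r_t c_t z4.
exists t'; split; rewrite -?(perm_size eq_t) //.
  by move=> P; rewrite -(seq.permP eq_t).
rewrite /unit_product -!(seq.permP eq_t) r_t c_t /=.
by clear -vals e2 nz4; lia.
Qed.

Lemma base_two s : size s = 10 -> has_unit 4 s.
Proof.
move=> sz_s; have [ps [r [eq_s tw Ur]]] := twin_decomposition s.
have szE : 2 * size ps + size r = 10.
  by rewrite -sz_s (perm_size eq_s) size_cat size_unpair.
suff : has_unit 4 (unpair ps ++ r).
  by apply: has_unit_sub => P; rewrite (seq.permP eq_s).
have [le4|gt4] := leqP (size r) 4.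
  apply: (@has_unit_sub _ _ (unpair ps)); first by move=> P; rewrite count_cat leq_addr.
  by apply: (@EGZ_pairs 2) => //; clear -szE le4; lia.
have le6 : 6 <= size r by clear -szE gt4; lia.
apply: (@has_unit_sub _ _ r); first by move=> P; rewrite count_cat leq_addl.
have [/hasP[e re /andP[odd_e rot_e]]|] :=
  boolP (has (fun e => odd (turn e) && ~~ refl e) r).
  have [u [t1 [t2 [sub_r [ru r1 r2 ne_t ne_u] bal]]]] :=
    distinct_parities_quad (odd (turn e)) (cent e) Ur le6.
  have par_e : parity e = (odd (turn e), false, cent e) by rewrite /parity (negbTE rot_e).
  (* The two values differ by twice the odd number [turn e]. *)
  apply: (@two_orders_unit r [:: t1; t2; e; u] [:: u; t1; e; t2]) => //.
  - exact: bal.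
  - have ne_e_u : e != u by apply: contra ne_u => /eqP <-; rewrite par_e.
    by rewrite /= !inE !negb_or ne_t ne_e_u !neq_refl.
  - by move=> x; rewrite !inE => /or4P[] /eqP-> //; apply: sub_r; rewrite !inE eqxx ?orbT.
  - by apply/seq.permP => P /=; clear; lia.
  rewrite /= r1 r2 (negbTE ru) (negbTE rot_e) !expr0 !expr1; clear -odd_e.
  lia.
move=> /hasPn no_odd.
(* Both classes of odd rotations are missing, so the elements of [r] fill the other six. *)
have all_refl o z : (o, true, z) \in map parity r.
  have no b : (true, false, b) \in map parity r = false.
    apply/negbTE/mapP => -[e /no_odd]; rewrite /parity => not_odd [eo er _].
    by move: not_odd; rewrite -eo -er.
  move: le6; rewrite -(count_parities Ur) /parities /= !no.
  by case: o; case: z; do 4![case: (_ \in _) => //=]; case: (_ \in _); case: (_ \in _).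
have [t0 rt0 [o0 r0 c0]] := mapP (all_refl false false).
have [t1 rt1 [o1 r1 c1]] := mapP (all_refl true false).
have [t2 rt2 [o2 r2 c2]] := mapP (all_refl false true).
have [t3 rt3 [o3 r3 c3]] := mapP (all_refl true true).
(* Exchanging [t0] and [t1] changes the value by twice an odd number. *)
apply: (@two_orders_unit r [:: t0; t1; t2; t3] [:: t1; t0; t2; t3]) => //.
- by rewrite /balanced /= -o0 -o1 -o2 -o3 -r0 -r1 -r2 -r3 -c0 -c1 -c2 -c3.
- apply: (@map_uniq _ _ parity); rewrite /= /parity.
  by rewrite -o0 -o1 -o2 -o3 -r0 -r1 -r2 -r3 -c0 -c1 -c2 -c3.
- by move=> x; rewrite !inE => /or4P[] /eqP->.
- by apply/seq.permP => P /=; clear; lia.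
rewrite /= -r0 -r1 -r2 -r3 !expr1; clear -o0 o1.
lia.
Qed.

(** * From [n] to a prime multiple of [n] *)

Lemma unit_product_flatten p n bs : prime p -> 0 < n ->
  all (unit_product n) bs -> size bs = p ->
  (p %| (\sum_(b <- bs) (val_prod b %/ n)%Z)%R)%Z -> unit_product (p * n) (flatten bs).
Proof.
move=> p_pr n0 /allP u_bs sz p_f; apply/and3P; split.
- rewrite count_flatten; elim: bs u_bs {sz p_f} => //= b bs IHbs u_bs.
  rewrite oddD; have /and3P[/negbTE -> _ _] := u_bs b (mem_head _ _).
  by apply: IHbs => x bx; apply: u_bs; rewrite inE bx orbT.
- rewrite count_flatten; elim: bs u_bs {sz p_f} => //= b bs IHbs u_bs.
  rewrite oddD; have /and3P[_ /negbTE -> _] := u_bs b (mem_head _ _).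
  by apply: IHbs => x bx; apply: u_bs; rewrite inE bx orbT.
rewrite val_flatten; last by apply/allP => b /u_bs /and3P[].
rewrite (eq_big_seq (fun b => (val_prod b %/ n)%Z * n)%R); last first.
  by move=> b /u_bs /and3P[_ _ /divzK->].
by rewrite -mulr_suml PoszM dvdz_mul.
Qed.

Definition unit_bound n := forall s, 2 * n + 2 <= size s -> has_unit n s.

Lemma unit_bound_exact n : (forall s, size s = 2 * n + 2 -> has_unit n s) -> unit_bound n.
Proof.
move=> H s le_s; apply: has_unit_sub (H (take (2 * n + 2) s) (size_takel le_s)).
by move=> P; apply: leq_count_subseq; apply: take_subseq.
Qed.

(** Before each of the [k] extractions at least [2 * n + 2] terms remain. *)
Lemma disjoint_units n k s : unit_bound n -> k.+1 * n + 2 <= size s ->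
  exists bs, [/\ size bs = k, all (fun b => unit_product n b && (size b == n)) bs
                & submset (flatten bs) s].
Proof.
move=> H; elim: k s => [|k IHk] s le_s; first by exists [::]; split=> // P.
have [|t [sub_t sz_t u_t]] := H s; first by apply: leq_trans le_s; nia.
have [r eq_s] := submset_rest sub_t.
have sz_s : size s = n + size r by rewrite (perm_size eq_s) size_cat sz_t.
have [|bs [sz_bs u_bs sub_bs]] := IHk r; first by move: le_s; rewrite sz_s; clear; nia.
exists (t :: bs); split; rewrite /= ?sz_bs ?u_t ?sz_t ?eqxx //.
by move=> P; rewrite (seq.permP eq_s) !count_cat leq_add2l.
Qed.

Lemma submset_flatten (T : eqType) (bs cs : seq (seq T)) :
  submset bs cs -> submset (flatten bs) (flatten cs).
Proof.
move=> /submset_rest[r /perm_flatten/seq.permP eq_cs] P.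
by rewrite eq_cs flatten_cat count_cat leq_addr.
Qed.

Lemma unit_bound_mul p n : prime p -> 0 < n -> unit_bound n -> unit_bound (p * n).
Proof.
move=> p_pr n0 H s le_s; have p0 := prime_gt0 p_pr.
(* [2 * (p * n) + 2] is exactly the length needed for [2 * p - 1] blocks. *)
have [|bs [sz_bs u_bs sub_bs]] := @disjoint_units n (2 * p - 1) s H.
  by apply: leq_trans le_s; rewrite subn1 prednK ?muln_gt0 // mulnA.
have [|cs [sub_cs sz_cs p_cs]] := EGZ_prime p_pr (fun b => (val_prod b %/ n)%Z) (s := bs).
  by rewrite sz_bs.
have /allP u_cs := submset_all sub_cs u_bs.
exists (flatten cs); split.
- exact: submset_trans (submset_flatten sub_cs) sub_bs.
- rewrite -sz_cs; elim: cs u_cs {sub_cs sz_cs p_cs} => //= c cs IHcs u_cs.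
  rewrite size_cat IHcs => [|x cx]; last by apply: u_cs; rewrite inE cx orbT.
  by have /andP[_ /eqP ->] := u_cs c (mem_head _ _); rewrite mulSn.
by apply: unit_product_flatten => //; apply/allP => c /u_cs /andP[].
Qed.

Lemma unit_bound_even n : 4 <= n -> ~~ odd n -> unit_bound n.
Proof.
move=> n4 n_even; have -> : n = 2 * n./2 by rewrite mul2n even_halfK.
have : 1 < n./2 by clear -n4; lia.
elim/ltn_ind: n./2 => {n n4 n_even} m IHm m1.
have [m_pr|] := boolP (prime m).
  apply: unit_bound_exact => s sz_s; have [m2|m_odd] := even_prime m_pr.
    by rewrite m2 in sz_s *; apply: base_two.
  by apply: base_odd => //; rewrite sz_s mulnA.
move=> m_npr; set p := pdiv m; have p_pr : prime p by apply: pdiv_prime.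
have def_m : m = p * (m %/ p) by rewrite mulnC divnK ?pdiv_dvd.
have lt_pm : p < m.
  rewrite ltn_neqAle pdiv_leq ?(ltnW m1) // andbT; apply: contra m_npr => /eqP <-.
  exact: pdiv_prime.
have m'1 : 1 < m %/ p by rewrite -(ltn_pmul2l (prime_gt0 p_pr)) muln1 -def_m.
rewrite def_m mulnCA; apply: unit_bound_mul => //; first by rewrite muln_gt0 /= (ltnW m'1).
by apply: IHm => //; apply: ltn_Pdiv (prime_gt1 p_pr) (ltnW m1).
Qed.

(** * The invariants *)

Definition triv : code := (0, false, false).

Lemma short_unit n (s : seq code) : 0 < n -> unit_bound n -> n + 3 <= size s ->
  exists t, [/\ submset t s, 1 <= size t <= n & unit_product n t].
Proof.
move=> n0 H le_s; have [s_triv|no_triv] := boolP (triv \in s).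
  exists [:: triv]; split=> //; last by rewrite /unit_product /= mulr0 addr0 dvdz0.
  by apply: submset_mem => // e; rewrite inE => /eqP->.
(* Padding with [n - 1] identities reaches length [2 * n + 2]; as [s] has no [triv], something is
   left of [t] once these are deleted. *)
have [|t [sub_t sz_t /and3P[r_t c_t v_t]]] := H (s ++ nseq n.-1 triv).
  by rewrite size_cat size_nseq; clear -n0 le_s; lia.
have cnt_t P : count P [seq e <- t | e != triv] + P triv * count_mem triv t = count P t.
  elim: t {sub_t sz_t r_t c_t v_t} => [|e t IHt] /=; first by rewrite muln0.
  have [->|_] := eqVneq e triv; rewrite /= -IHt mulnDr ?muln1 ?muln0 ?add0n ?addnA //.
  by congr (_ + _); rewrite addnC.
exists [seq e <- t | e != triv]; split.
- move=> P; rewrite count_filter.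
  apply: leq_trans (sub_t _) _; rewrite count_cat count_nseq /= ?eqxx andbF mul0n addn0.
  by apply: sub_count => e /= /andP[].
- have := cnt_t predT; rewrite !count_predT sz_t => sz.
  have := sub_t (pred1 triv); rewrite count_cat count_nseq /= ?eqxx (count_memPn no_triv).
  by move: sz; clear -n0; rewrite /=; lia.
have val_t' : val_prod [seq e <- t | e != triv] = val_prod t.
  elim: t {sub_t sz_t r_t c_t v_t cnt_t} => //= e t IHt.
  by have [->|_] := eqVneq e triv; rewrite /= IHt // expr0 mul1r add0r.
by move: r_t c_t; rewrite /unit_product val_t' v_t -(cnt_t refl) -(cnt_t cent) !addn0 => -> ->.
Qed.

(** The codes of [x ^ (n - 1), z, xz, y], of length [n + 2]; padded with [n - 1] identities they
    also give the lower bound for [s]. *)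
Definition extremal_codes n : seq code :=
  nseq n.-1 (1, false, false) ++ [:: (0, false, true); (1, false, true); (0, true, false)].

Lemma extremal_codes_unit n (t : seq code) : 1 < n ->
    submset t (extremal_codes n ++ nseq n.-1 triv) -> size t <= n -> unit_product n t ->
  count_mem triv t = size t.
Proof.
move=> n1 sub_t sz_t /and3P[r_t c_t v_t].
pose ex : code := (1, false, false); pose ez : code := (0, false, true).
pose exz : code := (1, false, true); pose ey : code := (0, true, false).
have all5 : all (mem [:: triv; ex; ez; exz; ey]) t.
  by apply: submset_all sub_t _; rewrite !all_cat !all_nseq !orbT.
have [szE rE cE vE] : [/\ size t = count_mem triv t + count_mem ex t + count_mem ez t
      + count_mem exz t + count_mem ey t, count refl t = count_mem ey t,
    count cent t = count_mem ez t + count_mem exz t &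
    (\sum_(e <- t) (turn e)%:Z = (count_mem ex t + count_mem exz t)%:Z)%R].
  elim: t all5 {sub_t sz_t r_t c_t v_t} => [|e t IHt] /=; first by rewrite big_nil.
  case/andP => e5 /IHt[-> -> -> eq_v]; rewrite big_cons eq_v.
  move: e5; rewrite !inE; case/or4P => [|||/orP[]] /eqP-> /=;
    split; rewrite ?/turn /=; clear; lia.
move: szE rE cE vE => /= szE rE cE vE.
have cnt (e : code) : count_mem e t <= count_mem e (extremal_codes n ++ nseq n.-1 triv).
  exact: sub_t.
move: (cnt ex) (cnt ez) (cnt exz) (cnt ey).
rewrite !count_cat !count_nseq /= => le_x le_z le_xz le_y.
(* A single reflection is available, and an even number is required. *)
have y0 : count_mem ey t = 0 by move: r_t; rewrite rE /=; clear -le_y; lia.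
move: v_t; rewrite val_rotations ?vE => [|]; last first.
  by rewrite all_predC has_count rE y0.
rewrite dvdzE /= => v_t; rewrite szE y0.
have zE : count_mem ez t = count_mem exz t.
  by move: c_t; rewrite cE /=; clear -le_z le_xz; lia.
(* If [ez] and [exz] both occurred, divisibility by [n] would force all [n - 1] copies of [ex],
   hence length [n + 1]. *)
have xz0 : count_mem exz t = 0.
  apply/eqP; rewrite -leqn0 leqNgt; apply/negP => xz1.
  have := dvdn_leq _ v_t; rewrite szE in sz_t; rewrite /= in xz1 zE *.
  by clear -xz1 zE sz_t le_xz; lia.
have x0 : count_mem ex t = 0.
  move: v_t; rewrite xz0 addn0; have [//|x1 /dvdn_leq] := posnP (count_mem ex t).
  by move=> /(_ x1) /=; move: x1 => /= x1; clear -le_x n1; lia.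
by rewrite zE xz0 x0 !addn0.
Qed.

(** [decode] is not injective, so a permutation of the images is lifted through positions in the
    list. *)
Lemma perm_eq_map (T1 T2 : eqType) (f : T1 -> T2) s t : perm_eq t (map f s) ->
  exists2 s', perm_eq s' s & t = map f s'.
Proof.
case: s => [|x0 s0]; first by move/perm_nilP->; exists [::].
move: (x0 :: s0) => {s0} s /(perm_iotaP (f x0))[I perm_I ->].
rewrite size_map in perm_I; exists [seq nth x0 s i | i <- I].
  by apply/(perm_iotaP x0); exists I.
rewrite -map_comp; apply/eq_in_map => i.
rewrite (perm_mem perm_I) mem_iota add0n => /andP[_ lt_i] /=.
by rewrite (nth_map x0).
Qed.

(** * Transfer from codes to the group *)

Section Invariants.
Variables (n : nat) (n_ge4 : 4 <= n) (n_even : ~~ odd n).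
Variables (x y : 'D_(2 * n)).
Hypotheses (ox : #[x]%g = n) (y2 : (y ^+ 2 = 1)%g) (xy : (x ^ y = x^-1)%g).
Hypotheses (Xy : y \notin <[x]>%g)
  (genXY : forall g, exists (i : nat) (b : bool), g = (x ^+ i * y ^+ b)%g).
Local Notation G := (dihedral_times_C2 n).
Local Notation dec := (decode x y).
Let n_gt0 : 0 < n. Proof. exact: leq_trans n_ge4. Qed.

Lemma mem_G g : g \in G. Proof. by case: g => a b; rewrite !inE. Qed.

Lemma prod_nseq_decode e k : (\prod_(c <- nseq k e) dec c = dec e ^+ k)%g.
Proof. by rewrite big_nseq -Monoid.iteropE. Qed.

Lemma val_nseq_even e : (n %| val_prod (nseq n e))%Z.
Proof.
have [r_e|r_e] := boolP (refl e).
  (* Equal reflections cancel two by two. *)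
  have val0 h : val_prod (nseq h.*2 e) = 0%R.
    by elim: h => //= h IHh; rewrite r_e !expr1 IHh; clear; lia.
  by rewrite -(even_halfK n_even) val0 dvdz0.
rewrite val_rotations ?all_nseq ?r_e ?orbT // big_nseq iter_addr addr0.
by rewrite -mulr_natr natz dvdz_mull.
Qed.

Lemma exponent_G : exponent G = n.
Proof.
apply/eqP; rewrite eqn_dvd; apply/andP; split.
  apply/exponentP => g _; have [e <-] := decode_surj genXY g.
  rewrite -prod_nseq_decode (prod_decode1 n_gt0 ox y2 xy) ?val_nseq_even //.
  - by rewrite count_nseq oddM (negbTE n_even) andbF.
  - by rewrite count_nseq oddM (negbTE n_even) andbF.
have : (dec (1%N, false, false) ^+ exponent G = 1)%g by rewrite expg_exponent // mem_G.
rewrite -prod_nseq_decode => /(prod_decode_eq1 n_gt0 ox y2 xy Xy)[_ _].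
rewrite val_rotations ?all_nseq ?orbT // big_nseq iter_addr addr0.
by rewrite natz dvdzE.
Qed.

Lemma unit_submset_product (t s : seq code) : submset t s -> unit_product n t ->
  exists T, [/\ subseq T (map dec s), size T = size t & 1%g \in product_set T].
Proof.
move=> sub_t /and3P[r_t c_t v_t].
have /count_subseqP[T sub_T eq_T] g :
    count_mem g (map dec t) <= count_mem g (map dec s).
  by rewrite !count_map.
exists T; split=> //; first by rewrite -(perm_size eq_T) size_map.
rewrite inE; apply/mapP; exists (map dec t); first by rewrite mem_permutations.
by rewrite big_map (prod_decode1 n_gt0 ox y2 xy).
Qed.

Lemma product_submset_unit (s : seq code) T :
    subseq T (map dec s) -> 1%g \in product_set T ->
  exists t, [/\ submset t s, size t = size T & unit_product n t].
Proof.
move=> /subseqP[m _ def_T]; rewrite inE => /mapP[T']; rewrite mem_permutations.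
rewrite -map_mask in def_T; rewrite def_T => /perm_eq_map[t eq_t ->].
rewrite big_map => /esym/(prod_decode_eq1 n_gt0 ox y2 xy Xy)[r_t c_t v_t].
exists t; split.
- by move=> P; rewrite (seq.permP eq_t); apply: leq_count_subseq; apply: mask_subseq.
- by rewrite (perm_size eq_t) size_map.
by apply/and3P.
Qed.

Lemma s_invariant_G : s_invariant G = 2 * n + 2.
Proof.
rewrite /s_invariant; case: ex_minnP => l /andP[_ /asboolP sl] min_l.
apply/eqP; rewrite eqn_leq; apply/andP; split.
  apply: min_l; rewrite addn_gt0 orbT; apply/asboolP => S _ le_S.
  have [s def_S] := decode_seq_surj genXY S; rewrite def_S size_map in le_S *.
  have [t [sub_t sz_t u_t]] := unit_bound_even n_ge4 n_even le_S.
  have [T [sub_T sz_T T1]] := unit_submset_product sub_t u_t.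
  by exists T; split; rewrite // sz_T exponent_G.
rewrite leqNgt; apply/negP => lt_l.
have [||T [sub_T sz_T T1]] := sl (map dec (extremal_codes n ++ nseq n.-1 triv)).
- by move=> g _; apply: mem_G.
- by rewrite size_map !size_cat !size_nseq /=; clear -lt_l n_ge4; lia.
have [t [sub_t sz_t u_t]] := product_submset_unit sub_T T1.
rewrite exponent_G in sz_T; have n1 : 1 < n by apply: leq_trans n_ge4.
have := extremal_codes_unit n1 sub_t _ u_t; rewrite sz_t sz_T => /(_ (leqnn n)).
(* The unit subsequence would consist of [n] identities, but only [n - 1] are present. *)
have := sub_t (pred1 triv); rewrite !count_cat !count_nseq /=.
by clear -n_ge4; lia.
Qed.

Lemma eta_invariant_G : eta_invariant G = n + 3.
Proof.
rewrite /eta_invariant; case: ex_minnP => l /andP[_ /asboolP sl] min_l.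
apply/eqP; rewrite eqn_leq; apply/andP; split.
  apply: min_l; rewrite addn_gt0 orbT; apply/asboolP => S _ le_S.
  have [s def_S] := decode_seq_surj genXY S; rewrite def_S size_map in le_S *.
  have [t [sub_t sz_t u_t]] := short_unit n_gt0 (unit_bound_even n_ge4 n_even) le_S.
  have [T [sub_T sz_T T1]] := unit_submset_product sub_t u_t.
  by exists T; split; rewrite // sz_T exponent_G.
rewrite leqNgt; apply/negP => lt_l.
have [||T [sub_T sz_T T1]] := sl (map dec (extremal_codes n)).
- by move=> g _; apply: mem_G.
- by rewrite size_map size_cat size_nseq /=; clear -lt_l n_ge4; lia.
have [t [sub_t sz_t u_t]] := product_submset_unit sub_T T1.
rewrite exponent_G -sz_t in sz_T; have n1 : 1 < n by apply: leq_trans n_ge4.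
have /andP[t_gt0 le_t] := sz_T.
have sub_t' : submset t (extremal_codes n ++ nseq n.-1 triv).
  by move=> P; rewrite count_cat; apply: leq_trans (sub_t P) (leq_addr _ _).
have := sub_t (pred1 triv); rewrite (extremal_codes_unit n1 sub_t' le_t u_t).
by rewrite !count_cat !count_nseq /= mul0n leqNgt t_gt0.
Qed.

End Invariants.

Theorem theorem3p2 (n : nat) (n_ge4 : 4 <= n) (n_even : ~~ odd n) :
  [/\ s_invariant (dihedral_times_C2 n) = 2 * n + 2,
      eta_invariant (dihedral_times_C2 n) = n + 3
    & s_invariant (dihedral_times_C2 n) =
        eta_invariant (dihedral_times_C2 n)
          + exponent (dihedral_times_C2 n) - 1].
Proof.
have [|x [y [ox y2 xy Xy genXY]]] := @dihedral_generators n; first exact: leq_trans n_ge4.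
rewrite (s_invariant_G n_ge4 n_even ox y2 xy Xy genXY).
rewrite (eta_invariant_G n_ge4 n_even ox y2 xy Xy genXY).
rewrite (exponent_G n_ge4 n_even ox y2 xy Xy genXY); split=> //.
by clear -n_ge4; lia.
Qed.
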